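(* There exist two non-finitely related semigroups whose direct product is finitely related.
   Context: An operation $f:A^n\to A$ preserves a relation $R\subseteq A^k$ if $f(r_1,\dots,r_n)\in R$ for all $r_1,\dots,r_n\in R$, with $f$ applied coordinatewise. An algebra $\mathbf{A}$ with universe $A$ is finitely related if there is a finite set of finitary relations on $A$ such that the finitary operations on $A$ preserving all of those relations are precisely the term functions of $\mathbf{A}$; otherwise it is non-finitely related. Semigroups are regarded as algebras with a single binary operation; the $n$-ary term functions of a semigroup are those induced by words in $n$ variables. *)

(* Defs.v *)
From mathcomp Require Import all_boot.

Set Implicit Arguments.
Unset Strict Implicit.
Unset Printing Implicit Defensive.

Local Open Scope group_scope.

Section Clones.
Variable A : Type.

(* Tuples in A^n are finite functions, so that operations and relations are
   extensional in their arguments without any axiom. *)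
Definition operation (n : nat) : Type := {ffun 'I_n -> A} -> A.
Definition relation (k : nat) : Type := {ffun 'I_k -> A} -> Prop.

Definition preserves (n k : nat) (f : operation n) (R : relation k) : Prop :=
  forall r : 'I_n -> {ffun 'I_k -> A},
    (forall i, R (r i)) -> R [ffun j => f [ffun i => r i j]].

(* [C n] is meant to be the set of n-ary term functions of an algebra on A.
   Operations have positive arity, as a semigroup has no nullary terms. *)
Definition determined_by_finitely_many_relations
    (C : forall n : nat, operation n -> Prop) : Prop :=
  exists (m : nat) (k : 'I_m -> nat) (R : forall i : 'I_m, relation (k i)),
    forall (n : nat) (f : operation n), 0 < n ->
      (forall i : 'I_m, preserves f (R i)) <-> C n f.

End Clones.

Section SemigroupTerms.
Variable A : semigroupType.

(* The value at x of the nonempty word with first letter i and remaining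
   letters w. *)
Definition eval_word (n : nat) (i : 'I_n) (w : seq 'I_n)
    (x : {ffun 'I_n -> A}) : A :=
  foldl (fun a j => a * x j) (x i) w.

Definition term_function (n : nat) (f : operation A n) : Prop :=
  exists (i : 'I_n) (w : seq 'I_n), f =1 eval_word i w.

Definition finitely_related : Prop :=
  determined_by_finitely_many_relations term_function.

End SemigroupTerms.

(* Main.v *)
Require Import Defs.
From HB Require Import structures.
From mathcomp Require Import all_boot all_order all_algebra.
From mathcomp Require Import ring lra zify.

Set Implicit Arguments.
Unset Strict Implicit.
Unset Printing Implicit Defensive.

Import Order.TTheory GRing.Theory Num.Theory.

(** Call an operation k-locally a term when it agrees with some word on any k
given arguments.  Relations of arity at most k cannot tell such an operation
from a term, so a semigroup in which every k admits a k-local term that is not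
a term is non-finitely related ([not_finitely_related]).  The two factors have
this defect for unrelated reasons, and each factor repairs the other.

The first factor, [light_words], consists of words over letters of weight
1/(b+1), b ranging over the naturals, where a product is zero ([None]) unless
its total weight is below 1.  The empty word apart, its elements are nilpotent,
but of unbounded index: on finitely many arguments a long enough power of x is
zero, whereas no single power is zero throughout.  On the other hand every word
survives on letters that are light enough.

The second factor, [abab_rat], is the product of the words in two letters that
are factors of abab, again truncated by a zero, with the additive group of the
rationals.  The word x0 x1 x0 x2 x1 x3 x2 ... mentions each variable twice, and
two variables i, j have the pattern i j i j in it exactly when j comes right
after i in the chosen order.  The truncated words see this pattern and hardly
anything else, so the chains that arise by cutting one n-cycle of variables at
different places are distinguished only by the place of the cut.  The operation
that shows no cut at all is a term on any fewer than n arguments, but not a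
term, as it would need a cyclic order of first occurrences.

In the product, the rational coordinate of an operation that preserves the
graph of addition is additive, hence gives a length that limits the weight of
the word coordinate, and the truncation can be avoided; the word coordinate
then displays the whole word, which repairs the second factor.  A second
relation, [word_rel], makes this precise.  The letters are (b, c, i), where c
codes a finite tuple of elements of the product itself and i is a position in
this tuple, so one relation of arity 5 can say that the last coordinate is the
value of the word in the first coordinate, under the substitution of the i-th
entry of the tuple c for the letter (b, c, i).  That all letters of a word
have the same code is enforced by additive quantities alone: if a sequence of
numbers has mean m and mean square m^2, it is constant. *)

(** * Values of words *)

Section WordValue.
Variables (I : Type) (S : semigroupType).
Implicit Types (x : I -> S) (u v : seq I).

(** Agrees with [eval_word] on nonempty words; as the empty word has no value in
a semigroup, an equation [word_value x u = Some a] also says that [u] is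
nonempty. *)
Definition word_value x u : option S :=
  if u is i :: w then Some (foldl (fun a j => a * x j)%g (x i) w) else None.

Lemma foldl_mulg x a b w :
  foldl (fun c j => c * x j)%g (a * b)%g w =
  (a * foldl (fun c j => c * x j) b w)%g.
Proof. by elim: w b => //= j w IH b; rewrite -mulgA IH. Qed.

Lemma word_value_cat x u v a b :
  word_value x u = Some a -> word_value x v = Some b ->
  word_value x (u ++ v) = Some (a * b)%g.
Proof.
case: u => //= i u [<-]; case: v => //= j v [<-].
by rewrite foldl_cat /= foldl_mulg.
Qed.

End WordValue.

Lemma eq_in_word_value (I : eqType) (S : semigroupType) (x y : I -> S) u :
  {in u, x =1 y} -> word_value x u = word_value y u.
Proof.
case: u => //= i u xy; congr Some; rewrite xy ?inE ?eqxx //.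
have {}xy : {in u, x =1 y} by move=> j ju; rewrite xy // inE ju orbT.
elim: u (y i) xy => //= j u IH a xy; rewrite xy ?inE ?eqxx // IH // => l lu.
by rewrite xy // inE lu orbT.
Qed.

Lemma word_value_map (I J : Type) (S : semigroupType) (g : J -> I)
    (x : I -> S) u :
  word_value x (map g u) = word_value (x \o g) u.
Proof.
case: u => //= i u; congr Some.
by elim: u (x (g i)) => //= j u IH a.
Qed.

Lemma word_value_morph (I : Type) (S T : semigroupType) (h : S -> T)
    (x : I -> S) i w :
  {morph h : a b / (a * b)%g} ->
  h (foldl (fun a j => a * x j)%g (x i) w) =
  foldl (fun a j => a * h (x j))%g (h (x i)) w.
Proof.
by move=> hM; elim: w (x i) => //= j w IH a; rewrite IH hM.
Qed.

(** * Relations and term functions *)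

Section Preservation.
Variable A : semigroupType.

Definition subsemigroup_rel k (R : relation A k) : Prop :=
  forall r s, R r -> R s -> R [ffun j => (r j * s j)%g].

Lemma term_function_preserves n (f : operation A n) k (R : relation A k) :
  term_function f -> subsemigroup_rel R -> preserves f R.
Proof.
move=> [i [w fE]] RM r Rr.
suff [s Rs sE] : exists2 s, R s &
    forall j, s j = foldl (fun a l => a * r l j)%g (r i j) w.
  suff -> : [ffun j => f [ffun l => r l j]] = s by [].
  apply/ffunP=> j; rewrite ffunE fE sE /eval_word ffunE.
  by elim: w (r i j) {fE sE} => //= l w IH a; rewrite ffunE.
elim/last_ind: w {fE} => [|w l [s Rs sE]]; first by exists (r i).
exists [ffun j => (s j * r l j)%g]; first exact: RM.
by move=> j; rewrite ffunE sE foldl_rcons.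
Qed.

(** The columns of an array of arguments are what one chooses in practice: each
column is one argument of [f], each row one element of [R]. *)
Lemma preserves_columns n (f : operation A n) k (R : relation A k)
    (c : 'I_k -> {ffun 'I_n -> A}) :
  preserves f R -> (forall i, R [ffun j => c j i]) -> R [ffun j => f (c j)].
Proof.
move=> fR Rc; have := fR (fun i => [ffun j => c j i]) Rc.
congr R; apply/ffunP=> j; rewrite !ffunE; congr f.
by apply/ffunP=> i; rewrite !ffunE.
Qed.

(** A relation of arity at most [k] tests an operation on at most [k] arguments
at a time, on which a term cannot be told from an operation that agrees with it
there. *)
Lemma not_finitely_related :
  (forall k, exists n (f : operation A n),
    [/\ 0 < n, ~ term_function f &
      forall X : seq {ffun 'I_n -> A}, size X <= k ->
        exists i w, {in X, f =1 eval_word i w}]) ->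
  ~ finitely_related A.
Proof.
move=> H [m [k [R detR]]].
have [n [f [n_gt0 f_nt f_loc]]] := H (\max_i k i).
apply: f_nt; apply/(detR n f n_gt0) => i r Rr.
pose X := [seq [ffun l => r l j] | j <- enum 'I_(k i)].
have [|i0 [w fE]] := f_loc X.
  by rewrite size_map size_enum_ord leq_bigmax.
have t_term : term_function (eval_word i0 w : operation A n) by exists i0, w.
have /(_ i r Rr) := (detR n _ n_gt0).2 t_term.
congr R; apply/ffunP=> j; rewrite !ffunE fE //.
by apply: map_f; rewrite mem_enum.
Qed.

End Preservation.

Lemma determined_by_two (A : Type) (C : forall n, operation A n -> Prop)
    k1 k2 (R1 : relation A k1) (R2 : relation A k2) :
  (forall n (f : operation A n), 0 < n ->
     preserves f R1 /\ preserves f R2 <-> C n f) ->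
  determined_by_finitely_many_relations C.
Proof.
move=> H.
exists 2, (fun i => if val i is 0 then k1 else k2).
exists (fun i => match val i as m
                 return relation A (if m is 0 then k1 else k2) with
                 | 0 => R1 | _.+1 => R2 end).
move=> n f n_gt0; split=> [pf|/(H n f n_gt0)[p1 p2] [[|[|[]]] i2] //].
by apply/(H n f n_gt0); split; [apply: (pf ord0)|apply: (pf (lift ord0 ord0))].
Qed.

(** * Truncated words *)

Definition factor_closed (T : Type) (P : pred (seq T)) : Prop :=
  forall u v, P (u ++ v) -> P u /\ P v.

(** [None] is the zero.  Words outside [P] are kept as elements, which avoids a
subtype; each of their products is zero, since [P] is closed under factors. *)
Definition truncated_word (T : Type) (P : pred (seq T)) (_ : factor_closed P) :
  Type := option (seq T).

Section TruncatedWords.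
Variables (T : countType) (P : pred (seq T)) (Pf : factor_closed P).

Local Notation W := (truncated_word Pf).

HB.instance Definition _ := Countable.copy W (option (seq T)).

Definition trunc (u : seq T) : W := if P u then Some u else None.

Definition truncated_mul (x y : W) : W :=
  if (x, y) is (Some u, Some v) then trunc (u ++ v) else None.

Lemma truncated_mul_truncl u v :
  truncated_mul (trunc u) (Some v) = trunc (u ++ v).
Proof.
rewrite {1}/trunc; case: ifP => //= Pu; rewrite /trunc.
by case: ifP => // /Pf[]; rewrite Pu.
Qed.

Lemma truncated_mul_truncr u v :
  truncated_mul (Some u) (trunc v) = trunc (u ++ v).
Proof.
rewrite {1}/trunc; case: ifP => //= Pv; rewrite /trunc.
by case: ifP => // /Pf[]; rewrite Pv.
Qed.

Lemma truncated_mulA : associative truncated_mul.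
Proof.
move=> [u|] [v|] [w|] //.
- rewrite -[LHS]/(truncated_mul (Some u) (trunc (v ++ w))).
  rewrite -[RHS]/(truncated_mul (trunc (u ++ v)) (Some w)).
  by rewrite truncated_mul_truncl truncated_mul_truncr catA.
- by rewrite /truncated_mul; case: (trunc _).
Qed.

HB.instance Definition _ := isSemigroup.Build W truncated_mulA.

Lemma foldl_trunc I (x : I -> W) (v : I -> seq T) u w :
  (forall l, x l = Some (v l)) ->
  foldl (fun a l => a * x l)%g (trunc u) w = trunc (u ++ flatten (map v w)).
Proof.
move=> xv; elim: w u => [|l w IH] u /=; first by rewrite cats0.
by rewrite xv [(_ * _)%g]truncated_mul_truncl IH catA.
Qed.

Lemma truncated_word_value I (x : I -> W) (v : I -> seq T) i j w :
  (forall l, x l = Some (v l)) ->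
  word_value x [:: i, j & w] =
  Some (trunc (flatten [seq v l | l <- [:: i, j & w]])).
Proof.
move=> xv; rewrite /= !xv [(_ * _)%g](_ : _ = trunc (v i ++ v j)) //.
by rewrite (foldl_trunc _ _ xv) catA.
Qed.

Lemma truncated_word_value_None (I : eqType) (x : I -> W) l w :
  l \in w -> x l = None -> word_value x w = Some None.
Proof.
case: w => // i w lw xl; congr Some.
have N u : foldl (fun a j => a * x j)%g (None : W) u = None by elim: u.
move: lw; rewrite inE; case: eqP => [<- _|_ /= /splitPr[p q]].
  by rewrite xl N.
rewrite foldl_cat /= xl; set a := foldl _ _ p.
by rewrite (_ : (a * _)%g = None) ?N //; case: a.
Qed.

End TruncatedWords.

(** * Words of bounded weight *)

Definition rat_add : Type := rat.

HB.instance Definition _ := Countable.copy rat_add rat.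
HB.instance Definition _ := isSemigroup.Build rat_add (@addrA rat).

(** A letter (b, c, i): the depth b fixes the weight, the code c stands for a
finite tuple of elements of the final direct product, and the slot i for a
position in it. *)
Definition letter : Type := (nat * nat * nat)%type.
HB.instance Definition _ := Countable.copy letter (nat * nat * nat)%type.

Definition depth (l : letter) : nat := l.1.1.
Definition code (l : letter) : nat := l.1.2.
Definition slot (l : letter) : nat := l.2.

Definition weight (u : seq letter) : rat :=
  \sum_(l <- u) (depth l).+1%:R^-1.

Definition light (u : seq letter) : bool := (weight u < 1)%R.

Lemma weight_cat u v : weight (u ++ v) = (weight u + weight v)%R.
Proof. exact: big_cat. Qed.

Lemma weight_ge0 u : (0 <= weight u)%R.
Proof. by apply: sumr_ge0 => l _; rewrite invr_ge0 ler0n. Qed.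

Lemma weight_gt0 u : u != [::] -> (0 < weight u)%R.
Proof.
case: u => // l u _; rewrite /weight big_cons.
by apply: ltr_wpDr; [exact: weight_ge0|rewrite invr_gt0 ltr0n].
Qed.

Lemma weight_flatten_nseq N u :
  weight (flatten (nseq N u)) = (N%:R * weight u)%R.
Proof.
elim: N => [|N IH]; first by rewrite /weight big_nil mul0r.
by rewrite /= weight_cat IH -natr1; ring.
Qed.

Lemma light_factor_closed : factor_closed light.
Proof.
move=> u v; rewrite /light weight_cat.
by have := weight_ge0 u; have := weight_ge0 v; split; lra.
Qed.

Definition light_words : Type := truncated_word light_factor_closed.
HB.instance Definition _ := Countable.on light_words.
HB.instance Definition _ := Semigroup.on light_words.

Lemma light_words_nseq (x : light_words) (u : seq letter) N :
  x = Some u ->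
  word_value (fun _ : 'I_1 => x) (nseq N.+2 ord0) =
  Some (trunc light_factor_closed (flatten (nseq N.+2 u))).
Proof.
move=> ->; rewrite (truncated_word_value (v := fun=> u)) //.
by congr (Some (trunc _ (flatten _))); rewrite /= map_nseq.
Qed.

(** Every exponent above this [N] annihilates all the given nonempty words. *)
Lemma weights_bounded_below (X : seq light_words) :
  exists N, forall u, Some u \in X -> u != [::] -> (1 <= N%:R * weight u)%R.
Proof.
elim: X => [|[v|] X [N HN]]; first by exists 0.
- exists (N + Num.bound (weight v)^-1) => u.
  rewrite inE natrD => /predU1P[[->]|uX] u0.
    have w0 := weight_gt0 u0; set b := Num.bound _.
    have ltb : ((weight v)^-1 < b%:R)%R by rewrite archi_boundP // invr_ge0 ltW.
    have : ((weight v)^-1 * weight v < b%:R * weight v)%R by rewrite ltr_pM2r.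
    rewrite mulVf ?gt_eqF // mulrDl => /ltW/le_trans; apply.
    by rewrite lerDr mulr_ge0 // ?ltW // ler0n.
  apply: le_trans (HN _ uX u0) _.
  by rewrite ler_pM2r ?weight_gt0 // lerDl ler0n.
- by exists N => u; rewrite inE => /predU1P[] //; apply: HN.
Qed.

(** The witness, for every [k], is the pointwise limit of the powers of x, which
sends everything but the empty word to zero.  It is no power: a letter of
sufficient depth survives any given one. *)
Lemma light_words_not_finitely_related : ~ finitely_related light_words.
Proof.
apply: not_finitely_related => k.
pose f : operation light_words 1 :=
  fun x => if x ord0 == Some [::] then Some [::] else None.
exists 1, f; split=> //.
- move=> [i [w fE]].
  (* The word has [(size w).+1] letters, each then of weight
     [1 / (size w + 2)]. *)
  pose l : letter := (size w + 1, 0, 0).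
  pose x : {ffun 'I_1 -> light_words} := [ffun=> Some [:: l]].
  have xl j : x j = Some [:: l] by rewrite ffunE.
  move: (congr1 Some (fE x)); rewrite {1}/f xl /=.
  rewrite -[X in _ = X]/(word_value x (i :: w)).
  case: w {fE} @l @x xl => [|j w] l x xl; first by rewrite /= xl.
  rewrite (truncated_word_value _ _ _ xl).
  rewrite (_ : map _ _ = nseq (size w).+2 [:: l]); last first.
    by congr [:: _, _ & _]; elim: (w) => //= ? ? ->.
  rewrite /trunc ifT // /light weight_flatten_nseq /weight big_seq1 /=.
  by rewrite ltr_pdivrMr ?ltr0n // mul1r ltr_nat /depth /= addn1.
- move=> X _; pose X0 := [seq x ord0 | x : {ffun 'I_1 -> light_words} <- X].
  have [N HN] := weights_bounded_below X0.
  exists ord0, (nseq N.+1 ord0) => x xX.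
  apply: Some_inj; rewrite -[RHS]/(word_value x (nseq N.+2 ord0)).
  have xE : x =1 fun=> x ord0 by move=> i; rewrite (ord1 i).
  rewrite (@eq_in_word_value _ _ _ _ _ (in1W xE)) /f.
  case x0: (x ord0) => [u|]; last first.
    by rewrite (truncated_word_value_None (l := ord0)) // inE eqxx.
  rewrite (light_words_nseq _ (erefl _)); congr Some.
  case: eqP => [[->]|/eqP u0].
    rewrite (_ : flatten _ = [::]); last by elim: N {HN}.
    by rewrite /trunc ifT // /light /weight big_nil.
  rewrite /trunc ifF // /light weight_flatten_nseq.
  apply/negbTE; rewrite -leNgt.
  have uX : Some u \in X0 by rewrite -x0; apply: map_f.
  apply: le_trans (HN u uX _) _; first by apply: contraNneq u0 => ->.
  by rewrite ler_wpM2r ?weight_ge0 // ler_nat -addn2 leq_addr.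
Qed.

(** * The factors of abab *)

Definition abab : seq bool := [:: true; false; true; false].

Lemma infix_abab_factor_closed : factor_closed (fun u => infix u abab).
Proof. by move=> u v h; split; [apply: catr_infix h|apply: catl_infix h]. Qed.

Definition abab_words : Type := truncated_word infix_abab_factor_closed.
HB.instance Definition _ := Countable.on abab_words.
HB.instance Definition _ := Semigroup.on abab_words.

Definition substitute I T (v : I -> seq T) (w : seq I) : seq T :=
  flatten (map v w).

Lemma eq_substitute (I : Type) T (v v' : I -> seq T) w :
  v =1 v' -> substitute v w = substitute v' w.
Proof. by move=> vv'; rewrite /substitute (eq_map vv'). Qed.

Lemma substitute_nil (I : eqType) T (v : I -> seq T) w :
  {in w, forall l, v l = [::]} -> substitute v w = [::].
Proof.
elim: w => // l w IH vw; rewrite /substitute /= vw ?inE ?eqxx //.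
by apply: IH => l' l'w; apply: vw; rewrite inE l'w orbT.
Qed.

(** * Zigzag words *)

Section Zigzag.
Variable I : eqType.
Implicit Types (i j x y : I) (s : seq I).

Fixpoint zigzag x s : seq I :=
  if s is y :: s' then [:: y, x & zigzag y s'] else [:: x].

Definition zigzag_word s : seq I :=
  if s is x :: s' then x :: zigzag x s' else [::].

(** Counting letters, a zigzag word is two copies of its sequence, so zigzag
words over the same set differ only by the order of letters. *)
Lemma perm_zigzag_word s : perm_eq (zigzag_word s) (s ++ s).
Proof.
apply/permP => a; rewrite count_cat; case: s => //= x s.
elim: s x => [|y s IH] x /=; first by rewrite !addn0.
by move: (IH y); lia.
Qed.

(** With [true] for a and [false] for b: the substitution that singles out the
variables [i] and [j]; for distinct [i] and [j] it turns a word into abab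
exactly when the restriction to these variables is i j i j. *)
Definition pair_subst i j l : seq bool :=
  if l == i then [:: true] else if l == j then [:: false] else [::].

Lemma pair_subst_nil i j l : l != i -> l != j -> pair_subst i j l = [::].
Proof. by rewrite /pair_subst => /negPf-> /negPf->. Qed.

Lemma substitute_pair_zigzag_tail i j s :
  i != j -> i \notin s -> j \notin s ->
  substitute (pair_subst i j) (zigzag j s) = [:: false].
Proof.
move=> ij; case: s => [|y s] is_ js.
  by rewrite /substitute /pair_subst /= eqxx eq_sym (negPf ij).
rewrite /substitute /= -/(substitute _ _) substitute_nil => [|l].
  rewrite pair_subst_nil; [|by apply: contraNneq is_ => <-; rewrite inE eqxx
                           |by apply: contraNneq js => <-; rewrite inE eqxx].
  by rewrite /pair_subst eq_sym (negPf ij) eqxx.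
move=> lz; have ls : l \in y :: s.
  have := perm_mem (perm_zigzag_word (y :: s)) l.
  by rewrite mem_cat orbb => <-; rewrite inE lz orbT.
by apply: pair_subst_nil;
  [apply: contraNneq is_ => <-|apply: contraNneq js => <-].
Qed.

(** Neighbours overlap in the zigzag word: their restriction is i j i j. *)
Lemma substitute_pair_zigzag i j s1 s2 :
  uniq (s1 ++ [:: i, j & s2]) ->
  substitute (pair_subst i j) (zigzag_word (s1 ++ [:: i, j & s2])) = abab.
Proof.
elim: s1 => [|x s1 IH] /=.
  rewrite inE negb_or => /and3P[/andP[ij iu] ju _].
  rewrite /substitute /= -/(substitute _ _).
  rewrite substitute_pair_zigzag_tail ?inE ?negb_or ?ij //.
  by rewrite /pair_subst !eqxx eq_sym (negPf ij).
move=> /andP[xs us]; rewrite -[RHS](IH us).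
have [xi xj] : x != i /\ x != j.
  by move: xs; rewrite mem_cat !inE !negb_or => /and4P[].
case: s1 xs us {IH} => [|y s1] xs us;
  by rewrite /substitute /= /pair_subst (negPf xi) (negPf xj).
Qed.

(** Neighbours in the reverse order yield baba.  Variables that are not
neighbours do not overlap: one of them has both its occurrences before the
other, which yields aabb or bbaa. *)
Lemma substitute_pair_zigzag_adjacent i j s :
  uniq s -> i != j -> substitute (pair_subst i j) (zigzag_word s) = abab ->
  exists s1 s2, s = s1 ++ [:: i, j & s2].
Proof.
move=> + ij; elim: s => // x s IH /= /andP[xs us].
case: s xs us IH => [|y s].
  by rewrite /substitute /= /pair_subst; case: eqP => // _; case: eqP.
move=> xs us IH; rewrite /substitute /= -/(substitute _ _).
have [xi|xi] := eqVneq x i.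
  subst x; have [->|yj] := eqVneq y j; first by exists [::], s.
  have yi : y != i by apply: contraNneq xs => ->; rewrite inE eqxx.
  by rewrite (pair_subst_nil yi yj) /pair_subst eqxx.
have [->|xj] := eqVneq x j.
  by rewrite /pair_subst eq_sym (negPf ij) eqxx.
rewrite (pair_subst_nil xi xj) /=.
by move=> /(IH us)[s1 [s2 ->]]; exists (x :: s1), s2.
Qed.

Lemma next_adjacent i j s1 s2 :
  uniq (s1 ++ [:: i, j & s2]) -> next (s1 ++ [:: i, j & s2]) i = j.
Proof.
rewrite next_nth mem_cat !inE eqxx orbT => us.
have i1 : i \notin s1.
  by move: us; rewrite cat_uniq /= negb_or => /and3P[_ /andP[]].
rewrite index_cat (negPf i1) /= eqxx addn0.
case: s1 {us i1} => //= y s1.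
by rewrite -cat_rcons nth_cat size_rcons ltnn subnn.
Qed.

Lemma next_cases i j x s :
  uniq (x :: s) -> i \in x :: s -> next (x :: s) i = j ->
  (i = last x s /\ j = x) \/ exists s1 s2, x :: s = s1 ++ [:: i, j & s2].
Proof.
move=> us ixs; have [s1 [s2 E]] : exists s1 s2, x :: s = s1 ++ i :: s2.
  by case/splitPr: ixs => s1 s2; exists s1, s2.
case: s2 E => [|k s2] E; last first.
  by rewrite E next_adjacent -?E // => <-; right; exists s1, s2.
have i_last : i = last x s by rewrite -(last_cons x) E last_cat.
rewrite next_nth ixs => <-; left; split=> //.
by rewrite nth_default // i_last index_last.
Qed.

End Zigzag.

(** * Substitutions into words that use each variable twice *)

Lemma substitute_single (I : eqType) T (v : I -> seq T) i w :
  (forall l, l != i -> v l = [::]) ->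
  substitute v w = flatten (nseq (count_mem i w) (v i)).
Proof.
move=> vi; elim: w => // l w IH; rewrite /substitute /= -/(substitute _ _) IH.
by case: eqVneq => [->|/vi->].
Qed.

Lemma size_substitute (I : finType) T (v : I -> seq T) w :
  perm_eq w (enum I ++ enum I) ->
  size (substitute v w) = (\sum_l size (v l)).*2.
Proof.
move=> pw; rewrite size_flatten sumnE !big_map (perm_big _ pw) big_cat /=.
by rewrite -!big_enum addnn.
Qed.

(** A nonzero value is at most four letters long, and each letter substituted
appears twice, so at most two variables receive something.  If only one does,
the order of the word is invisible.  If two do, each receives one letter, and
the value is abab itself. *)
Lemma double_word_abab (I : finType) (v : I -> seq bool) (w w' : seq I) :
  perm_eq w (enum I ++ enum I) -> perm_eq w' (enum I ++ enum I) ->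
  infix (substitute v w) abab ->
  substitute v w' = substitute v w \/
  exists i j, [/\ i != j, v =1 pair_subst i j & substitute v w = abab].
Proof.
move=> pw pw' inf.
case: (pickP (fun i => v i != [::])) => [i vi|v0]; last first.
  by left; rewrite !substitute_nil // => l _; apply/eqP/negbFE/v0.
case: (pickP (fun j => (j != i) && (v j != [::]))) => [j /andP[ji vj]|v0];
  last first.
  left; have vi0 l : l != i -> v l = [::].
    by move=> li; have := v0 l; rewrite li => /negbFE/eqP.
  by rewrite !(substitute_single _ vi0) (permP pw) (permP pw').
right.
have sz := size_substitute v pw; have le4 := size_infix inf.
rewrite sz (bigD1 i) // (bigD1 j) //= in le4.
have: 0 < size (v i) by case: (v i) vi.
have: 0 < size (v j) by case: (v j) vj.
set r := \sum_(l | _) _ in le4 * => szj szi.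
have [vi1 vj1 r0] : [/\ size (v i) = 1, size (v j) = 1 & r = 0].
  by move: le4 => /= le4; split; lia.
have vl l : l != i -> l != j -> v l = [::].
  move=> li lj; apply/eqP; rewrite -size_eq0; move: r0 => /eqP.
  by rewrite sum_nat_eq0 => /forallP/(_ l); rewrite li lj.
have imE : substitute v w = abab.
  have /infixP[p [q E]] := inf; have := congr1 size E; rewrite !size_cat sz.
  rewrite (bigD1 i) // (bigD1 j) //= -/r vi1 vj1 r0 => szE.
  case: p q E szE => [|? p] [|? q] //= E szE; try lia.
  by rewrite E cats0.
have ct (b : bool) : count_mem b (substitute v w) = 2.
  by rewrite imE; case: b.
move: vi1 vj1; case vi': (v i) => [|a []] // _; case vj': (v j) => [|b []] // _.
have ab : a != b.
  apply/eqP => ab; have := ct (~~ a).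
  rewrite count_flatten sumnE !big_map big1 // => l _.
  have [->|li] := eqVneq l i; first by rewrite vi' /=; case: (a).
  have [->|lj] := eqVneq l j; first by rewrite vj' -ab /=; case: (a).
  by rewrite vl.
case: a b ab vi' vj' => [] [] // _ vi' vj'; [exists i, j|exists j, i];
  split=> //; try by rewrite eq_sym.
all: move=> l; rewrite /pair_subst; do 2?[case: eqVneq => [->//|?]]; exact: vl.
Qed.

(** * Cutting a cycle of variables *)

Section Rotations.
Variable n : nat.
Hypothesis n_gt1 : 1 < n.
Local Notation I := 'I_n.

(** The linear order obtained by cutting the cycle just before [c]. *)
Definition rotation (c : I) : seq I := rot c (enum I).
Definition cyclic_pred (c : I) : I := last c (rotation c).
(** The substitution that tests whether [c] and its cyclic predecessor have the
pattern i j i j.  In the zigzag word of [rotation c'] they do, unless they are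
its two ends, that is, unless [c = c']. *)
Definition cut (c : I) : I -> seq bool := pair_subst (cyclic_pred c) c.

Lemma rotationE c : exists s, rotation c = c :: s.
Proof.
rewrite /rotation /rot (drop_nth c) ?size_enum_ord // nth_ord_enum /=.
by eexists.
Qed.

Lemma rotation_uniq c : uniq (rotation c).
Proof. by rewrite rot_uniq enum_uniq. Qed.

Lemma mem_rotation c i : i \in rotation c.
Proof. by rewrite mem_rot mem_enum. Qed.

Lemma cyclic_pred_neq c : cyclic_pred c != c.
Proof.
rewrite /cyclic_pred; have [[|x s] E] := rotationE c.
  have := size_rot c (enum I).
  rewrite size_enum_ord -/(rotation c) E => n1.
  by have := n_gt1; rewrite -{1}n1.
have := rotation_uniq c; rewrite E /= => /andP[cs _].
by apply: contraNneq cs => <-; apply: mem_last.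
Qed.

Lemma perm_rotation_word c :
  perm_eq (zigzag_word (rotation c)) (enum I ++ enum I).
Proof.
apply: perm_trans (perm_zigzag_word _) _.
by apply: perm_cat; rewrite perm_rot.
Qed.

(** All rotations have the same neighbours, up to the pairs that are cut. *)
Lemma rotation_next c c' i j s1 s2 :
  rotation c = s1 ++ [:: i, j & s2] ->
  (i = cyclic_pred c' /\ j = c') \/
  exists s1 s2, rotation c' = s1 ++ [:: i, j & s2].
Proof.
move=> E; have := next_adjacent (i := i) (j := j) (s1 := s1) (s2 := s2).
rewrite -E => /(_ (rotation_uniq c)).
rewrite /rotation next_rot ?enum_uniq // -(next_rot c') ?enum_uniq //.
rewrite -/(rotation c').
have := rotation_uniq c'; have := mem_rotation c' i; rewrite /cyclic_pred.
by have [s ->] := rotationE c'; move=> ic u /(next_cases u ic).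
Qed.

Lemma substitute_cut c c' :
  c != c' -> substitute (cut c) (zigzag_word (rotation c')) = abab.
Proof.
move=> cc'.
have E : next (rotation c) (cyclic_pred c) = c.
  have := rotation_uniq c; rewrite /cyclic_pred.
  have [s ->] := rotationE c => us.
  by rewrite last_cons next_nth mem_last nth_default // index_last.
have := mem_rotation c' (cyclic_pred c); have := rotation_uniq c'.
move: E; rewrite {1}/rotation next_rot ?enum_uniq //.
rewrite -(next_rot c') ?enum_uniq //.
rewrite -/(rotation c'); have [s ->] := rotationE c' => E us ic.
have [[_ cE]|[s1 [s2 E']]] := next_cases us ic E.
  by rewrite cE eqxx in cc'.
by rewrite E' substitute_pair_zigzag // -E'.
Qed.

(** A zigzag word that is nonzero under [v] is so by at most one variable or by a
pair of neighbours, and these are common to both rotations unless [v] tests the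
place where the second one is cut. *)
Lemma substitute_rotation c c' v :
  ~ v =1 cut c' -> infix (substitute v (zigzag_word (rotation c))) abab ->
  substitute v (zigzag_word (rotation c')) =
  substitute v (zigzag_word (rotation c)).
Proof.
move=> vc' inf.
have [//|[i [j [ij vij E]]]] :=
  double_word_abab (perm_rotation_word c) (perm_rotation_word c') inf.
rewrite E; rewrite !(eq_substitute _ vij) in E *.
have [s1 [s2 /rotation_next]] :=
  substitute_pair_zigzag_adjacent (rotation_uniq c) ij E.
case/(_ c') => [[iE jE]|[t1 [t2 E']]].
  by case: vc' => l; rewrite vij iE jE.
by rewrite E' substitute_pair_zigzag // -E' rotation_uniq.
Qed.

End Rotations.

Section CyclicOperation.
Variable n : nat.
Hypothesis n_gt1 : 1 < n.
Local Notation I := 'I_n.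
Local Notation M := abab_words.

Lemma rotation_word_cons c :
  exists j s, zigzag_word (rotation c) = [:: c, j & s] :> seq I.
Proof.
have [[|y s] E] := rotationE c; rewrite E /=;
  last by exists y, (c :: zigzag y s).
by exists c, [::].
Qed.

Definition rotation_value (x : I -> M) c : option M :=
  word_value x (zigzag_word (rotation c)).

Definition is_cut (x : I -> M) c : bool := [forall i, x i == Some (cut c i)].

Lemma is_cutP x c : reflect (forall i, x i = Some (cut c i)) (is_cut x c).
Proof. by apply: (iffP forallP) => h i; apply/eqP/h. Qed.

Lemma rotation_value_subst x v c :
  (forall i, x i = Some (v i)) ->
  rotation_value x c =
  Some (trunc infix_abab_factor_closed
          (substitute v (zigzag_word (rotation c)))).
Proof.
move=> xv; rewrite /rotation_value; have [j [s ->]] := rotation_word_cons c.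
exact: truncated_word_value.
Qed.

Lemma rotation_value_cut x c c' :
  c != c' -> is_cut x c -> rotation_value x c' = Some (Some abab).
Proof.
move=> cc' /is_cutP xc; rewrite (rotation_value_subst _ xc).
by rewrite substitute_cut.
Qed.

Lemma rotation_value_eq x c c' :
  ~~ is_cut x c -> ~~ is_cut x c' -> rotation_value x c = rotation_value x c'.
Proof.
move=> xc xc'; have [/existsP[i /eqP xi]|] := boolP [exists i, x i == None].
  have wi c0 : i \in zigzag_word (rotation c0).
    by rewrite (perm_mem (perm_rotation_word c0)) mem_cat mem_enum.
  by rewrite /rotation_value !(truncated_word_value_None (wi _) xi).
move=> /existsPn xS; pose v i : seq bool := odflt [::] (x i).
have xv i : x i = Some (v i) by rewrite /v; case: (x i) (xS i).
have nc c0 : ~~ is_cut x c0 -> ~ v =1 cut c0.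
  by move/is_cutP=> h vc; apply: h => i; rewrite xv vc.
rewrite !(rotation_value_subst _ xv) /trunc; congr Some.
have E c1 c2 := @substitute_rotation n c1 c2 v.
case: ifP => inf; first by rewrite (E c c') ?inf //; apply: nc.
by case: ifP => // inf'; rewrite (E c' c) ?inf' // in inf; apply: nc.
Qed.

Lemma is_cut_inj x c c' : is_cut x c -> is_cut x c' -> c = c'.
Proof.
move=> /is_cutP xc /is_cutP/(_ c); rewrite xc /cut /pair_subst eqxx.
rewrite eq_sym (negPf (cyclic_pred_neq n_gt1 c)).
by case: ifP => // _; case: eqP.
Qed.

End CyclicOperation.

(** * The second factor is non-finitely related *)

(** Pigeonhole: each element of [X] rules out at most one [c]. *)
Lemma exists_uncovered (T : eqType) (I : finType) (P : T -> I -> bool)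
    (X : seq T) :
  (forall x c c', P x c -> P x c' -> c = c') -> size X < #|I| ->
  exists c, {in X, forall x, ~~ P x c}.
Proof.
move=> P1 ltX.
case: (pickP (fun c => ~~ has (P^~ c) X)) => [c /hasPn|h]; first by exists c.
have hasX c : has (P^~ c) X by have /negbFE := h c.
suff : #|I| <= size X by rewrite leqNgt ltX.
case: X hasX {ltX h} => [|x0 X'] hasX.
  by case: (pickP I) => [/hasX//|I0]; rewrite (eq_card0 I0).
set X := x0 :: X' in hasX *; pose h c := find (P^~ c) X.
have h_inj : injective h.
  move=> c c' hc; apply: P1 (nth_find x0 (hasX c)) _.
  by rewrite -/(h c) hc; apply: (nth_find x0 (hasX c')).
rewrite cardE -(size_map h) -[leqRHS](size_iota 0); apply: uniq_leq_size.
  by rewrite map_inj_uniq ?enum_uniq.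
by move=> _ /mapP[c _ ->]; rewrite mem_iota /= -has_find.
Qed.

Definition abab_rat : Type := (abab_words * rat_add)%type.
HB.instance Definition _ := Countable.on abab_rat.
HB.instance Definition _ := Semigroup.on abab_rat.

Lemma eval_word_fst (S T : semigroupType) n (i : 'I_n) w
    (x : {ffun 'I_n -> S * T}) :
  Some (eval_word i w x).1 = word_value (fun j => (x j).1) (i :: w).
Proof.
congr Some; exact: (@word_value_morph _ _ _ fst x i w).
Qed.

Lemma foldl_rat_add I (x : I -> rat_add) a w :
  foldl (fun b j => b * x j)%g a w = (a + \sum_(j <- w) (x j : rat))%R :> rat.
Proof.
elim: w a => [|j w IH] a /=; first by rewrite big_nil addr0.
by rewrite IH big_cons addrA.
Qed.

Lemma eval_word_rat (S : semigroupType) n (i : 'I_n) w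
    (x : {ffun 'I_n -> S * rat_add}) :
  (eval_word i w x).2 = (\sum_(j <- i :: w) ((x j).2 : rat))%R.
Proof.
rewrite big_cons -(foldl_rat_add (fun j => (x j).2)).
exact: (@word_value_morph _ _ _ snd x i w).
Qed.

(** For n = k + 2 the witness is an operation [f] that takes the value abab at
every test of a pair of cyclic neighbours.  It agrees with the zigzag word of
[rotation c] except at arguments which test the cut at [c], and k arguments
cannot test all n cuts.  No word has all these values: if its first variable is
[i], then testing the pair of [i] and its predecessor gives b first. *)
Lemma abab_rat_not_finitely_related : ~ finitely_related abab_rat.
Proof.
apply: not_finitely_related => k; pose n := k.+2.
have n_gt1 : 1 < n by [].
pose word (c : 'I_n) := zigzag_word (rotation c).
have wordE c : exists j s, word c = [:: c, j & s] by exact: rotation_word_cons.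
pose fstf (x : {ffun 'I_n -> abab_rat}) j := (x j).1.
pose t (c : 'I_n) : operation abab_rat n := eval_word c (behead (word c)).
have t1 c x : Some (t c x).1 = rotation_value (fstf x) c.
  rewrite eval_word_fst /rotation_value -/(word c).
  by have [j [s ->]] := wordE c.
have t2 c x : (t c x).2 = (t ord0 x).2.
  have tE c' : (t c' x).2 = (\sum_(j <- word c') ((x j).2 : rat))%R.
    by rewrite /t eval_word_rat; have [j [s ->]] := wordE c'.
  rewrite !tE; apply: perm_big.
  by rewrite (perm_trans (perm_rotation_word c)) // perm_sym perm_rotation_word.
pose f : operation abab_rat n := fun x =>
  (if is_cut (fstf x) ord0 then Some abab : abab_words else (t ord0 x).1,
   (t ord0 x).2).
(* [f] is defined from the term [t ord0]; these two facts make it independent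
   of the cut at [ord0]. *)
have f_cut x c : is_cut (fstf x) c -> (f x).1 = Some abab.
  rewrite /f /=; case: ifP => // /negbT x0 xc; apply: Some_inj.
  by rewrite t1 (rotation_value_cut _ xc) //; apply: contraNneq x0 => <-.
have ft c x : ~~ is_cut (fstf x) c -> f x = t c x.
  move=> xc; rewrite [RHS]surjective_pairing t2 /f; congr (_, _).
  apply: Some_inj; rewrite t1; case: ifP => [x0|/negbT x0].
    by rewrite (rotation_value_cut _ x0) //; apply: contraNneq xc => <-.
  by rewrite t1 (rotation_value_eq x0 xc).
exists n, f; split=> //.
- move=> [i [w fE]].
  pose x : {ffun 'I_n -> abab_rat} := [ffun j => (Some (cut i j), 0%R)].
  have xi j : fstf x j = Some (cut i j) by rewrite /fstf ffunE.
  have /f_cut fx : is_cut (fstf x) i by apply/is_cutP.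
  move: (congr1 Some fx); rewrite fE eval_word_fst -/(fstf x).
  have ci : cut i i = [:: false].
    by rewrite /cut /pair_subst eqxx eq_sym (negPf (cyclic_pred_neq n_gt1 i)).
  case: w {fE} => [|j w]; first by rewrite /= xi ci.
  rewrite (truncated_word_value _ _ _ xi) /trunc.
  by case: ifP => // _ []; rewrite /= ci.
- move=> X ltX.
  have [||c cX] := @exists_uncovered _ 'I_n (fun x c => is_cut (fstf x) c) X.
  + by move=> x c c'; apply: is_cut_inj.
  + by rewrite card_ord; apply: leq_ltn_trans ltX _.
  by exists c, (behead (word c)) => x /cX /ft.
Qed.

(** * The direct product is finitely related *)

Definition light_abab_rat : Type := (light_words * abab_rat)%type.
HB.instance Definition _ := Countable.on light_abab_rat.
HB.instance Definition _ := Semigroup.on light_abab_rat.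

Definition ratpart (d : light_abab_rat) : rat := d.2.2.

Lemma ratpartM (d e : light_abab_rat) :
  ratpart (d * e)%g = (ratpart d + ratpart e)%R.
Proof. by []. Qed.

Definition entries (l : letter) : seq light_abab_rat :=
  odflt [::] (unpickle (code l)).

Definition entry (l : letter) : light_abab_rat :=
  nth (None, (None, 0%R)) (entries l) (slot l).

(** Positive exactly when the slot lies inside the coded tuple, and then
determined by the code: letters with one common positive mark are valid
positions of one and the same tuple. *)
Definition mark (l : letter) : nat :=
  if slot l < size (entries l) then (code l).+1 else 0.

Definition power_sum k (u : seq letter) : rat :=
  (\sum_(l <- u) (mark l)%:R ^+ k)%R.

Local Notation i3 k := (@Ordinal 3 k isT).
Local Notation i5 k := (@Ordinal 5 k isT).

Definition sum_rel : relation light_abab_rat 3 :=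
  fun r => ratpart (r (i3 2)) = (ratpart (r (i3 0)) + ratpart (r (i3 1)))%R.

(** The last coordinate is the value of the word [u] of the first; the word [u']
of the second coordinate lets one compare the slots of [u] with those of a word
that is the same for all tuples.  The alternative [1 <= ratpart (r (i5 0))]
covers truncation: the rational part of the first coordinate is the total weight
even when the word is gone, and being at least 1 is inherited by products. *)
Definition word_rel : relation light_abab_rat 5 := fun r =>
  (1 <= ratpart (r (i5 0)))%R \/
  exists u u',
    [/\ (r (i5 0)).1 = Some u, (r (i5 1)).1 = Some u'
      & map slot u' = map slot u]
    /\
    [/\ ratpart (r (i5 0)) = weight u, weight u' = weight u
      & word_value entry u = Some (r (i5 4))] /\
    [/\ ratpart (r (i5 1)) = power_sum 0 u, ratpart (r (i5 2)) = power_sum 1 u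
      & ratpart (r (i5 3)) = power_sum 2 u].

Lemma sum_rel_subsemigroup : subsemigroup_rel sum_rel.
Proof.
move=> r s; rewrite /sum_rel !ffunE !ratpartM => -> ->.
by rewrite addrACA.
Qed.

Lemma power_sum_cat k u v :
  power_sum k (u ++ v) = (power_sum k u + power_sum k v)%R.
Proof. exact: big_cat. Qed.

Lemma light_words_mul (x y : light_words) u v :
  x = Some u -> y = Some v -> (weight (u ++ v) < 1)%R ->
  (x * y)%g = Some (u ++ v).
Proof. by move=> -> -> lt1; rewrite [LHS]/(trunc _ _) /trunc /light lt1. Qed.

Lemma word_rel_subsemigroup : subsemigroup_rel word_rel.
Proof.
move=> r s; rewrite /word_rel !ffunE !ratpartM.
case=> [r1|[u [u' [[r0 r1 uu'] [[w ww' val] [p0 p1 p2]]]]]];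
  case=> [s1|[v [v' [[s0 s1 vv'] [[z zz' val'] [q0 q1 q2]]]]]].
- by left; lra.
- by left; rewrite z; have := weight_ge0 v; lra.
- by left; rewrite w; have := weight_ge0 u; lra.
have [le1|lt1] := leP 1%R (weight (u ++ v)).
  by left; rewrite w z -weight_cat.
right; exists (u ++ v), (u' ++ v'); split; first split.
- exact: light_words_mul r0 s0 lt1.
- by apply: light_words_mul r1 s1 _; move: lt1; rewrite !weight_cat ww' zz'.
- by rewrite !map_cat uu' vv'.
rewrite !weight_cat w z ww' zz' !power_sum_cat p0 p1 p2 q0 q1 q2.
by split; split=> //; exact: word_value_cat.
Qed.

Section RatpartLinear.
Variables (n : nat) (f : operation light_abab_rat n).
Hypothesis f_sum : preserves f sum_rel.
Implicit Types d e : {ffun 'I_n -> light_abab_rat}.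

(** In particular the rational part of [f d] is a function of the rational parts
of [d]. *)
Lemma ratpart_add d1 d2 d3 :
  (forall i, ratpart (d3 i) = ratpart (d1 i) + ratpart (d2 i))%R ->
  ratpart (f d3) = (ratpart (f d1) + ratpart (f d2))%R.
Proof.
move=> dE; pose c (j : 'I_3) := nth d1 [:: d1; d2; d3] j.
have := preserves_columns (c := c) f_sum.
by rewrite /sum_rel !ffunE /c /=; apply=> i; rewrite !ffunE.
Qed.

Lemma ratpart_scale m d e :
  (forall i, ratpart (e i) = m%:R * ratpart (d i))%R ->
  ratpart (f e) = (m%:R * ratpart (f d))%R.
Proof.
elim: m e => [|m IH] e eE.
  (* Adding [e] to [d] does not change the rational parts. *)
  have /esym/eqP : (ratpart (f d) = ratpart (f d) + ratpart (f e))%R.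
    by apply: ratpart_add => i; rewrite eE mul0r addr0.
  by rewrite -subr_eq0 addrC addKr mul0r => /eqP.
pose g : {ffun 'I_n -> light_abab_rat} :=
  [ffun i => (None, (None, (m%:R * ratpart (d i))%R))].
have gE i : ratpart (g i) = (m%:R * ratpart (d i))%R by rewrite ffunE.
rewrite (ratpart_add (d1 := g) (d2 := d)); last first.
  by move=> i; rewrite eE gE -natr1; ring.
by rewrite (IH _ gE) -natr1; ring.
Qed.

End RatpartLinear.

(** The variance of the marks around [m] vanishes; the length of [u] is
[power_sum 0 u]. *)
Lemma power_sums_constant (u : seq letter) (m : nat) :
  power_sum 1 u = (m%:R * power_sum 0 u)%R ->
  power_sum 2 u = ((m ^ 2)%:R * power_sum 0 u)%R ->
  {in u, forall l, mark l = m}.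
Proof.
move=> p1 p2.
have var0 : (\sum_(l <- u) ((mark l)%:R - m%:R) ^+ 2 = 0 :> rat)%R.
  have -> : (\sum_(l <- u) ((mark l)%:R - m%:R) ^+ 2 =
    power_sum 2 u - 2 * m%:R * power_sum 1 u
      + m%:R ^+ 2 * power_sum 0 u :> rat)%R.
    rewrite /power_sum !mulr_sumr -sumrB -big_split /=.
    by apply: eq_bigr => l _; ring.
  by rewrite p1 p2 natrX; ring.
move=> l lu; apply/eqP; rewrite -(eqr_nat rat) -subr_eq0 -sqrf_eq0; apply/eqP.
move/eqP: var0; rewrite psumr_eq0 => [/allP/(_ l lu)/eqP//|i _].
exact: sqr_ge0.
Qed.

(** Depth [b] is chosen so large that letters of this depth are not truncated.
On the letters which code the tuple [x], the operation [f] yields a word [u].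
Its slots are those of [f base], hence do not depend on [x]; its letters are
valid positions of [x] by their marks; its value at the entries of [x] is
[f x]. *)
Lemma preserves_sum_word_rel_term_function n (f : operation light_abab_rat n) :
  0 < n -> preserves f sum_rel -> preserves f word_rel -> term_function f.
Proof.
move=> n_gt0 f_sum f_word.
pose const (q : rat) : light_abab_rat := (None, (None, q)).
pose letters b c i : light_words := Some [:: (b, c, val (i : 'I_n))].
pose unit_row : {ffun 'I_n -> light_abab_rat} := [ffun=> const 1%R].
pose len := ratpart (f unit_row).
pose b := Num.bound `|len|%R.
have lt_len : (len / b.+1%:R < 1)%R.
  rewrite ltr_pdivrMr ?ltr0n // mul1r (le_lt_trans (ler_norm _)) //.
  by rewrite (lt_trans (archi_boundP (normr_ge0 _))) // ltr_nat ltnSn.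
pose base : {ffun 'I_n -> light_abab_rat} :=
  [ffun i => (letters b 0 i, (None, 1%R))].
have base_len : ratpart (f base) = len.
  rewrite (ratpart_scale f_sum (m := 1) (d := unit_row)) ?mul1r // => i.
  by rewrite !ffunE mul1r.
pose i0 := Ordinal n_gt0; pose to_ord (k : nat) : 'I_n := insubd i0 k.
suff H (x : {ffun 'I_n -> light_abab_rat}) :
    exists u v, [/\ (f base).1 = Some v, map slot v = map slot u,
      {in u, forall l, entry l = x (to_ord (slot l))} &
      word_value entry u = Some (f x)].
  (* Only the first component of [f base] is used, and it is given by [H] at any
     argument. *)
  have [_ [v [fv _ _ _]]] := H base.
  have val (x : {ffun 'I_n -> light_abab_rat}) :
      word_value x (map (to_ord \o slot) v) = Some (f x).
    have [u [v' [fv' vu xu <-]]] := H x.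
    have vv' : v = v' by apply: Some_inj; rewrite -fv.
    rewrite map_comp vv' vu -map_comp word_value_map.
    by apply: eq_in_word_value => l /xu.
  case: (map _ v) val => [|i w] val; first by have := val base.
  by exists i, w => x; apply: Some_inj; rewrite -val.
pose xs := [seq x i | i <- enum 'I_n].
pose c := pickle xs.
pose coded : {ffun 'I_n -> light_abab_rat} :=
  [ffun i => (letters b c i, (None, b.+1%:R^-1%R))].
pose marks k : {ffun 'I_n -> light_abab_rat} :=
  [ffun i => const (c.+1 ^ k)%:R%R].
pose col (j : 'I_5) := nth x [:: coded; base; marks 1; marks 2; x] j.
have entriesE l : code l = c -> entries l = xs.
  by rewrite /entries => ->; rewrite pickleK.
have size_xs : size xs = n by rewrite size_map size_enum_ord.
have markE l : code l = c -> slot l < n -> mark l = c.+1.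
  by move=> lc ln; rewrite /mark entriesE // size_xs ln lc.
have entryE l : code l = c -> slot l < n -> entry l = x (to_ord (slot l)).
  move=> lc ln; rewrite /entry entriesE // (nth_map i0) ?size_enum_ord //.
  by congr (x _); apply: val_inj; rewrite /= nth_enum_ord // val_insubd ln.
have col_rel i : word_rel [ffun j => col j i].
  right; exists [:: (b, c, val i)], [:: (b, 0, val i)].
  have lti : slot (b, c, val i) < n by exact: ltn_ord.
  have ps k : power_sum k [:: (b, c, val i)] = (c.+1 ^ k)%:R%R.
    by rewrite /power_sum big_seq1 markE ?natrX.
  have wt e : weight [:: (b, e, val i)] = b.+1%:R^-1%R.
    by rewrite /weight big_seq1.
  split; last split.
  - by split; rewrite ?ffunE.
  - split; rewrite ?wt // ffunE /col /=; first by rewrite ffunE.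
    congr Some; rewrite (entryE (b, c, val i) erefl lti).
    by congr (x _); apply: valKd.
  - by split; rewrite ps ffunE /col /= ffunE.
have := preserves_columns f_word col_rel.
have coded_len : ratpart (f coded) = (len / b.+1%:R)%R.
  have := ratpart_scale f_sum (m := b.+1) (d := coded) (e := unit_row).
  rewrite -/len => ->; last first.
    by move=> i; rewrite !ffunE /ratpart /= mulfV // pnatr_eq0.
  by rewrite mulrAC mulfV ?mul1r // pnatr_eq0.
have marks_len k : ratpart (f (marks k)) = ((c.+1 ^ k)%:R * len)%R.
  by apply: ratpart_scale => // i; rewrite !ffunE /ratpart /= mulr1.
rewrite /word_rel !ffunE /col /= coded_len base_len !marks_len.
case=> [|[u [v [[fu fv vu] [[_ _ val] [p0 p1 p2]]]]]].
  by rewrite leNgt lt_len.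
exists u, v; split=> // l lu.
have markl : mark l = c.+1.
  apply: (power_sums_constant (u := u)) lu; first by rewrite -p0 -p1 expn1.
  by rewrite -p0 -p2.
have [lc ln] : code l = c /\ slot l < n.
  move: markl; rewrite /mark; case: ifP => // ln [lc].
  by split=> //; rewrite -size_xs -(entriesE l lc).
exact: entryE.
Qed.

Lemma light_abab_rat_finitely_related : finitely_related light_abab_rat.
Proof.
apply: (determined_by_two (R1 := sum_rel) (R2 := word_rel)) => n f n_gt0.
split=> [[fs fw]|ft]; first exact: preserves_sum_word_rel_term_function.
by split; apply: term_function_preserves ft _;
  [exact: sum_rel_subsemigroup|exact: word_rel_subsemigroup].
Qed.

Theorem corollary4p20 :
  exists A B : semigroupType,
    ~ finitely_related A /\ ~ finitely_related B /\
    finitely_related (A * B)%type.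
Proof.
exists light_words, abab_rat.
split; first exact: light_words_not_finitely_related.
split; first exact: abab_rat_not_finitely_related.
exact: light_abab_rat_finitely_related.
Qed.
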